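(* Given an orthogonal partition $X=W_1\oplus\dots\oplus W_k$ (a direct sum of mutually orthogonal subspaces) and a line $L\subset X$, we have $\sum_{i=1}^k\cos^2\Theta_{L,W_i}=1$.
   Context: $X$ is an $n$-dimensional vector space over $\mathbb{R}$ (real case) or $\mathbb{C}$ (complex case) with an inner product $\langle\cdot,\cdot\rangle$ (Hermitian in the complex case, conjugate-linear in the left entry). Subspaces and dimensions are over the same field; a line is a 1-dimensional subspace (a complex line in the complex case). Principal angles: for nonzero subspaces $V,W\subset X$, with $p=\dim V$, $q=\dim W$, $m=\min\{p,q\}$, there are orthonormal bases $(e_1,\dots,e_p)$ of $V$ and $(f_1,\dots,f_q)$ of $W$ and uniquely determined numbers $0\le\theta_1\le\dots\le\theta_m\le\frac{\pi}{2}$ (the principal angles) such that $\langle e_i,f_j\rangle=\delta_{ij}\cos\theta_i$ (equal to $0$ whenever $i\neq j$). Grassmann angle: for nonzero subspaces $V,W\subset X$ with principal angles $\theta_1,\dots,\theta_m$, the Grassmann angle $\Theta_{V,W}\in[0,\frac{\pi}{2}]$ of $V$ with $W$ is $\Theta_{V,W}=\arccos(\cos\theta_1\cdots\cos\theta_m)$ if $\dim V\le\dim W$, and $\Theta_{V,W}=\frac{\pi}{2}$ if $\dim V>\dim W$. Also $\Theta_{\{0\},\{0\}}=\Theta_{\{0\},V}=0$ and $\Theta_{V,\{0\}}=\frac{\pi}{2}$ for $V\ne\{0\}$. *)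

(* Defs.v *)
From HB Require Import structures.
From mathcomp Require Import all_boot all_order all_algebra.
From mathcomp Require Import complex.
From mathcomp Require Import boolp classical_sets reals trigo.

Set Implicit Arguments.
Unset Strict Implicit.
Unset Printing Implicit Defensive.

Import Order.TTheory GRing.Theory Num.Theory.
Local Open Scope ring_scope.

Variant scalar_kind := RealScalars | ComplexScalars.

Definition scalar_field (R : realType) (K : scalar_kind) : numFieldType :=
  match K with RealScalars => R | ComplexScalars => R[i] end.

Definition scalar_conj (R : realType) (K : scalar_kind) :
    {rmorphism scalar_field R K -> scalar_field R K} :=
  match K with
  | RealScalars => idfun : {rmorphism R -> R}
  | ComplexScalars => Num.conj : {rmorphism R[i] -> R[i]}
  end.

Definition of_real (R : realType) (K : scalar_kind) : R -> scalar_field R K :=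
  match K with
  | RealScalars => fun x => x
  | ComplexScalars => fun x => (x%:C)%C
  end.

Section Grassmann.
Variables (R : realType) (K : scalar_kind) (X : vectType (scalar_field R K)).
Variable form : {dot X for scalar_conj R K}.
Implicit Types V W : {vspace X}.

(* [{dot X for theta}] is linear on the left and [theta]-linear on the right;
   [inner] swaps the arguments, so that it is conjugate-linear on the left. *)
Definition inner (u v : X) : scalar_field R K := form v u.

Definition orthonormal_basis V (e : seq X) : Prop :=
  basis_of V e /\ orthonormal form e.

Definition is_principal_angles V W (theta : seq R) : Prop :=
  [/\ size theta = minn (\dim V) (\dim W),
      sorted <=%R theta,
      (forall t, t \in theta -> 0 <= t <= pi / 2) &
      exists (e : (\dim V).-tuple X) (f : (\dim W).-tuple X),
        [/\ orthonormal_basis V e, orthonormal_basis W f &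
            forall (i : 'I_(\dim V)) (j : 'I_(\dim W)),
              inner e`_i f`_j =
                if i == j :> nat then of_real K (cos theta`_i) else 0]].

(* The principal angles always exist and are unique, so the default [::] of
   [xget] is never used. *)
Definition principal_angles V W : seq R :=
  xget [::] [set theta | is_principal_angles V W theta]%classic.

Definition grassmann_angle V W : R :=
  if V == 0%VS then 0
  else if W == 0%VS then pi / 2
  else if (\dim V <= \dim W)%N then
    acos (\prod_(t <- principal_angles V W) cos t)
  else pi / 2.

(* The [W i] are allowed to be zero. *)
Definition orthogonal_partition (k : nat) (W : 'I_k -> {vspace X}) : Prop :=
  [/\ (\sum_(i < k) W i)%VS = fullv,
      directv (\sum_(i < k) W i) &
      forall i j : 'I_k, i != j ->
        forall u v, u \in W i -> v \in W j -> inner u v = 0].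

End Grassmann.

(* Main.v *)
From HB Require Import structures.
Require Import Defs.
From mathcomp Require Import all_boot all_order all_algebra.
From mathcomp Require Import complex.
From mathcomp Require Import boolp classical_sets reals trigo.
Import Order.TTheory GRing.Theory Num.Theory.
Local Open Scope ring_scope.

(** Pick a unit vector [u] spanning the line [L] and write [u] as the sum of its
    components [w i] in the mutually orthogonal [W i].  Pythagoras gives
    [1 = form u u = \sum_i form (w i) (w i)], so it is enough to see that
    [cos (grassmann_angle form L (W i)) ^+ 2] is the squared norm of [w i]
    ([grassmann_angle_line_projection]).

    The other components being orthogonal to [W i], the vector [w i] is the
    orthogonal projection of [u] onto [W i].  A line has a single principal
    angle [t] with a nonzero subspace [V], and adapted orthonormal bases
    [[:: e0]] of [L] and [f0 :: s] of [V] satisfy [inner e0 f0 = cos t] and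
    [inner e0 f = 0] for [f] in [s].  Hence the projection of [a *: e0] onto
    [V] is [(a * cos t) *: f0], whose squared norm is [cos t ^+ 2] times that
    of [a *: e0] ([line_principal_angle_projection]).

    Since the principal angles are obtained by choice, such bases must also be
    shown to exist ([exists_line_principal_angle]): normalize the projection of
    [u] onto [V] to get [f0], taking any unit vector of [V] if the projection
    vanishes, and complete [u] and [f0] to orthonormal bases by Gram-Schmidt
    ([exists_orthonormal_basis]).  The real and complex cases are treated
    together, through the embedding [of_real] of the reals into the scalars. *)

Set Implicit Arguments.
Unset Strict Implicit.
Unset Printing Implicit Defensive.

(** * Real numbers among the scalars *)

Section ScalarField.
Variables (R : realType) (K : scalar_kind).

Lemma of_real_zmod_morphism : zmod_morphism (@of_real R K).
Proof. by case: K => x y //=; rewrite rmorphB. Qed.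

Lemma of_real_monoid_morphism : monoid_morphism (@of_real R K).
Proof. by case: K; split=> // x y /=; rewrite rmorphM. Qed.

HB.instance Definition _ :=
  GRing.isZmodMorphism.Build R (scalar_field R K) (@of_real R K)
    of_real_zmod_morphism.
HB.instance Definition _ :=
  GRing.isMonoidMorphism.Build R (scalar_field R K) (@of_real R K)
    of_real_monoid_morphism.

Lemma ler_of_real : {mono @of_real R K : x y / x <= y}.
Proof. by case: K => x y //=; rewrite lecR. Qed.

Lemma scalar_conj_of_real x : scalar_conj R K (of_real K x) = of_real K x.
Proof. by case: K => //=; exact: conjc_real. Qed.

(** The order of [R[i]] only compares numbers with equal imaginary parts, so a
    nonnegative scalar is real; this turns squared norms into real numbers. *)
Lemma ge0_of_real (z : scalar_field R K) :
  0 <= z -> exists2 r : R, 0 <= r & z = of_real K r.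
Proof.
case: K z => /= [z z0|[a b]]; first by exists z.
by rewrite lecE /= => /andP[/eqP-> a0]; exists a.
Qed.

End ScalarField.

(** * Orthonormal bases and orthogonal projections *)

Section InnerProduct.
Variables (R : realType) (K : scalar_kind) (X : vectType (scalar_field R K)).
Variable form : {dot X for scalar_conj R K}.
Implicit Types (u v w e : X) (V W L : {vspace X}).

Lemma dotC u v : form u v = scalar_conj R K (form v u).
Proof. by rewrite hermC mul1r. Qed.

Lemma dot_gt0 u : u != 0 -> 0 < form u u.
Proof. exact: neq0_dnorm_gt0. Qed.

Lemma dot_ge0 u : 0 <= form u u.
Proof. by have [->|/dot_gt0/ltW//] := eqVneq u 0; rewrite linear0r. Qed.

Lemma dot_eq0 u : (form u u == 0) = (u == 0).
Proof.
have [->|u0] := eqVneq u 0; first by rewrite linear0r eqxx.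
by rewrite gt_eqF ?dot_gt0.
Qed.

Lemma dot_scale_of_real (c : R) u :
  form (of_real K c *: u) (of_real K c *: u) = of_real K (c ^+ 2) * form u u.
Proof.
by rewrite linearZl_LR linearZr_LR /= scalar_conj_of_real mulrA -expr2 rmorphXn.
Qed.

Lemma exists_normalized u :
  u != 0 -> exists2 c : R, 0 < c &
    form (of_real K c^-1 *: u) (of_real K c^-1 *: u) = 1.
Proof.
move=> u0; have [r r0 ur] := ge0_of_real (dot_ge0 u).
have {}r0 : 0 < r.
  rewrite lt_def r0 andbT; apply: contra_neq u0 => r0'.
  by apply/eqP; rewrite -dot_eq0 ur r0' rmorph0.
exists (Num.sqrt r); first by rewrite sqrtr_gt0.
by rewrite dot_scale_of_real ur exprVn sqr_sqrtr ?ltW // -rmorphM mulVf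
  ?gt_eqF // rmorph1.
Qed.

Lemma exists_unit V : V != 0%VS -> exists2 e, e \in V & form e e = 1.
Proof.
rewrite -vpick0 => /exists_normalized[c _ ce1].
by exists (of_real K c^-1 *: vpick V) => //; rewrite rpredZ ?memv_pick.
Qed.

(** Gram-Schmidt, by induction on the dimension: the rest of the basis is an
    orthonormal basis of the hyperplane of [V] orthogonal to [e]. *)
Lemma exists_orthonormal_basis V e :
  e \in V -> form e e = 1 -> exists t, orthonormal_basis form V (e :: t).
Proof.
have [n] := ubnP (\dim V); elim: n V e => // n IHn V e leVn Ve e1.
have e0 : e != 0 by rewrite -dot_eq0 e1 oner_eq0.
pose W := (V :&: orthov form <[e]>)%VS.
have dimW : \dim V = (\dim W).+1.
  rewrite -eq_dim_orthov1 ?prednK //.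
    by rewrite lt0n dimv_eq0; apply: contra e0 => /eqP V0; rewrite -memv0 -V0.
  by apply/mem_orthovPn; exists e; rewrite //= e1 oner_eq0.
have WVE v : v \in W -> form e v = 0.
  by rewrite memv_cap mem_orthov1 herm_eq0C => /andP[_ /eqP].
have [t [tW ot]] : exists t, orthonormal_basis form W t.
  have [W0|/exists_unit[f Wf f1]] := eqVneq W 0%VS.
    by exists [::]; split=> //; rewrite W0 nil_basis.
  have [|t tP] := IHn W f _ Wf f1; last by exists (f :: t).
  by rewrite -dimW.
have et0 v : v \in t -> form e v = 0.
  by move=> tv; rewrite WVE // (basis_mem tW).
exists t; split; last first.
  move: ot; rewrite /orthonormal /= e1 eqxx /= => /andP[-> ->]; rewrite !andbT /=.
  by apply/allP => v /et0 /= ->.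
rewrite basisEdim dimW /= -(size_basis (tW : basis_of W (in_tuple t))) leqnn andbT.
apply/subvP => v Vv; rewrite span_cons (span_basis tW).
rewrite -(subrK (form v e *: e) v) addrC memv_add ?memvZ ?memv_line //.
rewrite memv_cap rpredB ?rpredZ //= mem_orthov1.
by rewrite linearBl linearZl_LR /= e1 mulr1 subrr.
Qed.

(** The difference of two orthogonal projections of [u] onto [W] lies in [W] and
    is orthogonal to [W], hence to itself. *)
Lemma orthogonal_projection_uniq W u v w :
  v \in W -> w \in W -> u - v \in orthov form W -> u - w \in orthov form W ->
  v = w.
Proof.
move=> Wv Ww uv uw; apply/eqP; rewrite -subr_eq0 -dot_eq0.
have /mem_orthovP/(_ (v - w)) -> // : v - w \in orthov form W.
  have -> : v - w = (u - w) - (u - v) by rewrite opprB [RHS]addrC subrKA.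
  by rewrite rpredB.
by rewrite rpredB.
Qed.

End InnerProduct.

(** * The angle of a line with a subspace *)

Section LineAngle.
Variables (R : realType) (K : scalar_kind) (X : vectType (scalar_field R K)).
Variable form : {dot X for scalar_conj R K}.
Implicit Types (u v w e : X) (V W L : {vspace X}).

Lemma projection_norm_le W u w : w \in W -> u - w \in orthov form W ->
  form w w <= form u u.
Proof.
move=> Ww /mem_orthovP/(_ w Ww)/= uw.
by rewrite -[in leRHS](subrK w u) hnormDd //= lerDr dot_ge0.
Qed.

(** When [w] is zero the scalar is zero and any unit vector of [W] will do, which
    is why [W] must be nonzero. *)
Lemma exists_unit_multiple W w : W != 0%VS -> w \in W ->
  exists c : R, exists2 f, f \in W &
    [/\ 0 <= c, form f f = 1 & w = of_real K c *: f].
Proof.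
move=> W0 Ww; have [->|] := eqVneq w 0.
  have [f Wf f1] := exists_unit form W0.
  by exists 0; exists f => //; split; rewrite // rmorph0 scale0r.
case/(exists_normalized form) => [c c0 f1]; exists c.
exists (of_real K c^-1 *: w); rewrite ?rpredZ //; split; rewrite ?ltW //.
by rewrite scalerA -rmorphM mulfV ?gt_eqF // rmorph1 scale1r.
Qed.

Lemma acos_ge0_le_pihalf (c : R) : 0 <= c <= 1 -> 0 <= acos c <= pi / 2.
Proof.
move=> /andP[c0 c1]; have c11 : -1 <= c <= 1.
  by rewrite c1 (le_trans _ c0) // lerN10.
rewrite acos_ge0 //= leNgt; apply: contraTN c0 => lt_pi.
rewrite -ltNge -(cos_pihalf R) -[ltLHS](acosK (x := c)) ?in_itv //=.
rewrite ltr_cos // in_itv /= ?acos_ge0 ?acos_lepi //.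
by rewrite divr_ge0 ?pi_ge0 //= ler_pdivrMr // ler_peMr ?pi_ge0 ?ler1n.
Qed.

(** The cosine of the angle is the norm [c] of the projection [w]; it is at most
    [1] because projecting does not increase norms. *)
Lemma exists_line_principal_angle L W u w :
  \dim L = 1%N -> W != 0%VS -> u \in L -> form u u = 1 ->
  w \in W -> u - w \in orthov form W ->
  exists theta, is_principal_angles form L W theta.
Proof.
move=> L1 W0 Lu u1 Ww uw.
have [c [f Wf [c0 f1 defw]]] := exists_unit_multiple W0 Ww.
have c1 : c <= 1.
  have := projection_norm_le Ww uw.
  rewrite u1 defw dot_scale_of_real f1 mulr1 -(rmorph1 (@of_real R K)).
  by rewrite ler_of_real expr_le1.
have [s [sL os]] := exists_orthonormal_basis Lu u1.
have [t [tW ot]] := exists_orthonormal_basis Wf f1.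
have sizes : size (u :: s) == \dim L by rewrite -(size_basis (X := in_tuple _) sL).
have sizet : size (f :: t) == \dim W by rewrite -(size_basis (X := in_tuple _) tW).
exists [:: acos c]; split=> //=.
- by rewrite L1; apply/esym/minn_idPl; rewrite lt0n dimv_eq0.
- by move=> a; rewrite inE => /eqP->; rewrite acos_ge0_le_pihalf ?c0.
exists (Tuple sizes), (Tuple sizet); split=> // i j.
have /= := ltn_ord i; rewrite {2}L1 ltnS leqn0 => /eqP i0; rewrite i0 /=.
have : (f :: t)`_j \in f :: t by rewrite mem_nth ?(eqP sizet).
move/(basis_mem tW) => Wj.
(* Only the component [w = c *: f] of [u] in [W] contributes, which leaves the
   orthonormality of [f :: t] scaled by [c]. *)
rewrite /inner dotC -(subrK w u) linearDl /= (mem_orthovP uw) // add0r.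
rewrite defw linearZl_LR rmorphM scalar_conj_of_real -dotC /= acosK; last first.
  by rewrite in_itv /= c1 (le_trans _ c0) // lerN10.
case: j Wj => -[|j] ltj _ /=; first by rewrite f1 mulr1.
move: ot; rewrite /orthonormal /= => /andP[_]; rewrite andbT => /andP[/allP ft _].
rewrite dotC (eqP (ft _ _)) ?rmorph0 ?mulr0 // mem_nth //.
by move: ltj; rewrite -{1}(eqP sizet).
Qed.

(** In adapted bases [[:: e0]] and [f0 :: s], the vector [a *: e0] projects to
    [(a * cos t) *: f0], so [w] is this vector. *)
Lemma line_principal_angle_projection L W u w theta :
  \dim L = 1%N -> W != 0%VS -> u \in L ->
  w \in W -> u - w \in orthov form W -> is_principal_angles form L W theta ->
  exists2 t, theta = [:: t] & 0 <= t <= pi / 2 /\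
    form w w = of_real K (cos t ^+ 2) * form u u.
Proof.
move=> L1 W0 Lu Ww uw [sztheta _ bnd [[e sze] [f [[eL oe] [fW of1] angles]]]].
have W_gt0 : (0 < \dim W)%N by rewrite lt0n dimv_eq0.
have L_gt0 : (0 < \dim L)%N by rewrite L1.
rewrite L1 (minn_idPl W_gt0) in sztheta.
case: theta sztheta bnd angles => [|t [|? ?]] //= _ bnd angles.
exists t => //; split; first by apply: bnd; rewrite mem_head.
have sze1 : size e = 1%N by rewrite (eqP sze).
case: e sze sze1 eL oe angles => [|e0 [|? ?]] //= sze _ eL oe angles.
have := W_gt0; case: f fW of1 angles => [[|f0 s] /= sizef] fW of1 angles.
  by rewrite -(eqP sizef).
move=> _.
have [f01 f0s] : form f0 f0 = 1 /\ (forall v, v \in s -> form f0 v = 0).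
  move: of1; rewrite /orthonormal /= andbT.
  case/andP=> [/andP[/eqP-> _]] /andP[/allP fs _].
  by split=> // v /fs/eqP.
have e01 : form e0 e0 = 1 by move: oe; rewrite /orthonormal /= !andbT => /eqP.
have [a defu] : exists a, u = a *: e0.
  by apply/vlineP; rewrite -span_seq1 (span_basis eL).
have -> : w = (a * of_real K (cos t)) *: f0.
  apply: orthogonal_projection_uniq Ww _ uw _.
    by rewrite rpredZ // (basis_mem fW) // mem_head.
  (* It suffices to test orthogonality on the basis [f0 :: s] of [W]. *)
  set w' := _ *: f0.
  rewrite memvE -span_seq1 -(span_basis fW) -orthogonalE.
  apply/orthogonalP => _ v /[!inE] /eqP-> /predU1P[->|sv].
    have := angles (Ordinal L_gt0) (Ordinal W_gt0); rewrite /inner /= => e0f0.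
    rewrite linearBl /= defu !linearZl_LR /= f01 mulr1 dotC e0f0.
    by rewrite scalar_conj_of_real subrr.
  have [j ltj <-] := nthP 0 sv.
  have ltjW : (j.+1 < \dim W)%N by rewrite -(eqP sizef).
  have := angles (Ordinal L_gt0) (Ordinal ltjW); rewrite /inner /= => e0fj.
  rewrite linearBl /= defu !linearZl_LR /= f0s ?mem_nth // mulr0 subr0.
  by rewrite dotC e0fj rmorph0 mulr0.
rewrite defu !linearZl_LR !linearZr_LR /= f01 e01 !mulr1.
by rewrite expr2 !rmorphM /= scalar_conj_of_real mulrACA mulrC.
Qed.

(** When [W] is zero so is [w], and the angle is then [pi / 2] by convention. *)
Lemma grassmann_angle_line_projection L W u w :
  \dim L = 1%N -> u \in L -> form u u = 1 ->
  w \in W -> u - w \in orthov form W ->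
  form w w = of_real K (cos (grassmann_angle form L W) ^+ 2).
Proof.
move=> L1 Lu u1 Ww uw; rewrite /grassmann_angle -dimv_eq0 L1 /=.
have [W0|W0] := eqVneq W 0%VS.
  move: Ww; rewrite W0 memv0 => /eqP->.
  by rewrite cos_pihalf expr0n rmorph0 linear0l.
rewrite lt0n dimv_eq0 W0.
have /(xgetPex [::]) := exists_line_principal_angle L1 W0 Lu u1 Ww uw.
case/(line_principal_angle_projection L1 W0 Lu Ww uw) => t.
rewrite -/(principal_angles form L W) => -> [/andP[t0 tpi] ->].
rewrite big_seq1 u1 mulr1 cosK // in_itv /= t0 (le_trans tpi) //.
by rewrite ler_pdivrMr // ler_peMr ?pi_ge0 ?ler1n.
Qed.

(** The components of [u] are its orthogonal projections, so that Pythagoras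
    applies to them. *)
Lemma orthogonal_partition_components k (W : 'I_k -> {vspace X}) u :
  orthogonal_partition form W ->
  exists w : 'I_k -> X, [/\ forall i, w i \in W i,
    forall i, u - w i \in orthov form (W i) &
    form u u = \sum_(i < k) form (w i) (w i)].
Proof.
case=> sumW _ orthW.
have /memv_sumP[w Ww defu] : u \in (\sum_(i < k) W i)%VS by rewrite sumW memvf.
have uw i : u - w i \in orthov form (W i).
  apply/mem_orthovP => v Wv /=.
  rewrite defu (bigD1 i) //= [w i + _]addrC addrK linear_sumlz big1 // => j ji.
  by apply: (orthW i j) => //; rewrite 1?eq_sym ?Ww.
exists w; split=> // [i|]; first exact: Ww.
rewrite {1}defu linear_sumlz; apply: eq_bigr => i _ /=.
by rewrite -[in LHS](subrK (w i) u) linearDr /= dotC (mem_orthovP (uw i)) ?Ww //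
  rmorph0 add0r.
Qed.

End LineAngle.

Unset Implicit Arguments.
Set Strict Implicit.
Set Printing Implicit Defensive.

Theorem theorem7p1 (R : realType) (K : scalar_kind) (X : vectType (scalar_field R K))
    (form : {dot X for scalar_conj R K}) (k : nat) (W : 'I_k -> {vspace X})
    (L : {vspace X}) :
  orthogonal_partition form W -> \dim L = 1%N ->
  \sum_(i < k) cos (grassmann_angle form L (W i)) ^+ 2 = 1.
Proof.
move=> partW L1.
have [|u Lu u1] := exists_unit form (V := L); first by rewrite -dimv_eq0 L1.
have [w [Ww uw uE]] := orthogonal_partition_components u partW.
apply: (fmorph_inj (@of_real R K)); rewrite rmorph1 rmorph_sum -u1 uE.
apply: eq_bigr => i _; apply/esym.
exact: grassmann_angle_line_projection L1 Lu u1 (Ww i) (uw i).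
Qed.
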